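(* Let $A\in\mathbb{R}^{m\times n}$, $\mathbf{b}\in\mathbb{R}^m$, $\mu>0$, let $c$ be a positive integer and $0\le\delta_c<1$, and assume that $A$ satisfies the restricted isometry property $$(1-\delta_c)\|\mathbf{x}\|^2\le\|A\mathbf{x}\|^2\le(1+\delta_c)\|\mathbf{x}\|^2\quad\text{for all }\mathbf{x}\in\mathbb{R}^n\text{ with }\mathrm{card}(\mathbf{x})\le c.$$ Let $f(\mathbf{x})=r_\mu(\mathbf{x})+\|A\mathbf{x}-\mathbf{b}\|^2$. Assume that $\mathbf{x}_s\in\mathbb{R}^n$ is a stationary point of $f$ and that each element $z_i$ of the vector $\mathbf{z}=(I-A^TA)\mathbf{x}_s+A^T\mathbf{b}$ fulfills $$|z_i|\notin\left[(1-\delta_c)\sqrt{\mu},\ \frac{\sqrt{\mu}}{1-\delta_c}\right].$$ If $\mathbf{x}_s'\ne\mathbf{x}_s$ is another stationary point of $f$, then $\mathrm{card}(\mathbf{x}_s'-\mathbf{x}_s)>c$.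
   Context: $\|\cdot\|$ is the Euclidean norm and $\mathrm{card}(\mathbf{x})$ is the number of non-zero elements of $\mathbf{x}$. For $\mathbf{x}\in\mathbb{R}^n$, $r_\mu(\mathbf{x})=\sum_i\left(\mu-\max(\sqrt{\mu}-|x_i|,0)^2\right)$. Let $g:\mathbb{R}\to\mathbb{R}$, $g(x)=r_\mu(x)+x^2$, i.e. $g(x)=\mu+x^2$ for $|x|\ge\sqrt{\mu}$ and $g(x)=2\sqrt{\mu}|x|$ for $|x|\le\sqrt{\mu}$. It is convex with sub-differential $\partial g(x)=\{2x\}$ if $|x|\ge\sqrt{\mu}$, $\partial g(x)=\{2\sqrt{\mu}\,\mathrm{sign}(x)\}$ if $0<|x|\le\sqrt{\mu}$, and $\partial g(0)=[-2\sqrt{\mu},2\sqrt{\mu}]$. For a vector $\mathbf{x}$, $\partial g(\mathbf{x})=\{\mathbf{w}: w_i\in\partial g(x_i)\ \forall i\}$. Since $f(\mathbf{x})=\sum_i g(x_i)+\mathbf{x}^T(A^TA-I)\mathbf{x}-2\mathbf{x}^TA^T\mathbf{b}+\mathbf{b}^T\mathbf{b}$, a point $\mathbf{x}$ is called a stationary point of $f$ if $2(I-A^TA)\mathbf{x}+2A^T\mathbf{b}\in\partial g(\mathbf{x})$. *)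

(* Defs.v *)
From HB Require Import structures.
From mathcomp Require Import all_boot all_order all_algebra.
From mathcomp Require Import boolp classical_sets reals.

Set Implicit Arguments.
Unset Strict Implicit.
Unset Printing Implicit Defensive.

Import Order.TTheory GRing.Theory Num.Theory.
Local Open Scope classical_set_scope.
Local Open Scope ring_scope.

Definition enorm (R : realType) (n : nat) (x : 'cV[R]_n) : R :=
  Num.sqrt (\sum_i x i 0 ^+ 2).

Definition card_nz (R : realType) (n : nat) (x : 'cV[R]_n) : nat :=
  #|[set i | x i 0 != 0]%SET|.

Definition restricted_isometry (R : realType) (m n : nat) (A : 'M[R]_(m, n))
    (c : nat) (delta : R) : Prop :=
  forall x : 'cV[R]_n, (card_nz x <= c)%N ->
    (1 - delta) * enorm x ^+ 2 <= enorm (A *m x) ^+ 2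
      <= (1 + delta) * enorm x ^+ 2.

Definition reg1 (R : realType) (mu t : R) : R :=
  mu - Num.max (Num.sqrt mu - `|t|) 0 ^+ 2.

Definition reg (R : realType) (n : nat) (mu : R) (x : 'cV[R]_n) : R :=
  \sum_i reg1 mu (x i 0).

Definition objective (R : realType) (m n : nat) (mu : R) (A : 'M[R]_(m, n))
    (b : 'cV[R]_m) (x : 'cV[R]_n) : R :=
  reg mu x + enorm (A *m x - b) ^+ 2.

Definition g_mu (R : realType) (mu t : R) : R := reg1 mu t + t ^+ 2.

Definition subdifferential (R : realType) (h : R -> R) (t : R) : set R :=
  [set w | forall s, h t + w * (s - t) <= h s].

Definition subdifferential_g (R : realType) (n : nat) (mu : R)
    (x : 'cV[R]_n) : set 'cV[R]_n :=
  [set w | forall i, subdifferential (g_mu mu) (x i 0) (w i 0)].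

(* The vector required to lie in the subdifferential is minus the gradient of
   the part of the objective that is left after removing the sum of the
   [g_mu mu (x i 0)]; see [objectiveE] for this splitting. *)
Definition stationary (R : realType) (m n : nat) (mu : R) (A : 'M[R]_(m, n))
    (b : 'cV[R]_m) (x : 'cV[R]_n) : Prop :=
  subdifferential_g mu x
    (2 *: ((1%:M - A^T *m A) *m x) + 2 *: (A^T *m b)).

Lemma enorm_sqr (R : realType) (n : nat) (x : 'cV[R]_n) :
  enorm x ^+ 2 = (x^T *m x) 0 0.
Proof.
rewrite /enorm sqr_sqrtr; last by apply: sumr_ge0 => i _; exact: sqr_ge0.
by rewrite mxE; apply: eq_bigr => i _; rewrite mxE expr2.
Qed.

Lemma objectiveE (R : realType) (m n : nat) (mu : R) (A : 'M[R]_(m, n))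
    (b : 'cV[R]_m) (x : 'cV[R]_n) :
  objective mu A b x =
  \sum_i g_mu mu (x i 0)
    + (x^T *m (A^T *m A - 1%:M) *m x - 2 *: (x^T *m A^T *m b) + b^T *m b) 0 0.
Proof.
have bAx : b^T *m (A *m x) = x^T *m A^T *m b.
  transitivity (b^T *m (A *m x))^T; last by rewrite !trmx_mul trmxK.
  by apply/matrixP => i j; rewrite [RHS]mxE !ord1.
rewrite /objective enorm_sqr.
have -> : \sum_i g_mu mu (x i 0) = reg mu x + (x^T *m x) 0 0.
  rewrite big_split /=; congr (_ + _).
  by rewrite mxE; apply: eq_bigr => i _; rewrite mxE expr2.
have -> : (A *m x - b)^T *m (A *m x - b) = x^T *m x +
    (x^T *m (A^T *m A - 1%:M) *m x - 2 *: (x^T *m A^T *m b) + b^T *m b).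
  rewrite [(_ - b)^T]linearB /= trmx_mul mulmxBl !mulmxBr bAx.
  rewrite mulmxBl mulmx1 !mulmxA.
  by rewrite scaler_nat mulr2n !opprD opprK !addrA [_ - x^T *m x]addrAC subrr add0r.
by rewrite [in LHS]mxE addrA.
Qed.

(* Main.v *)
(* Let z, z' be the vectors attached to the stationary points x, x' as in the
   statement, and let d = x' - x. Then z' - z = (I - A^T A) d, so if d is
   c-sparse the lower isometry bound gives <z' - z, d> <= delta |d|^2. On the
   other hand each pair (z_i, z'_i) consists of halves of subgradients of g at
   (x_i, x'_i), and the gap condition on |z_i| makes g so curved there that
   (z'_i - z_i) d_i > delta d_i^2 whenever d_i != 0. *)

Require Import Defs.
From HB Require Import structures.
From mathcomp Require Import all_boot all_order all_algebra.
From mathcomp Require Import boolp classical_sets reals.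
From mathcomp Require Import ring lra.

Set Implicit Arguments.
Unset Strict Implicit.
Unset Printing Implicit Defensive.

Import Order.TTheory GRing.Theory Num.Theory.
Local Open Scope ring_scope.

Section ScalarSubdifferential.
Variables (R : realType) (mu : R).
Hypothesis mu_gt0 : 0 < mu.
Local Notation s := (Num.sqrt mu).

Lemma g_mu_small t : `|t| <= s -> g_mu mu t = 2 * s * `|t|.
Proof.
move=> ts; have mus : s ^+ 2 = mu by rewrite sqr_sqrtr // ltW.
rewrite /g_mu /reg1 max_l ?subr_ge0 // -(real_normK (num_real t)) -{1}mus; ring.
Qed.

Lemma g_mu_large t : s <= `|t| -> g_mu mu t = mu + t ^+ 2.
Proof.
by move=> st; rewrite /g_mu /reg1 max_r ?subr_le0 // expr0n subr0.
Qed.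

Lemma g_mu_le t : g_mu mu t <= mu + t ^+ 2.
Proof. by rewrite /g_mu /reg1 lerD2r gerBl sqr_ge0. Qed.

Lemma g_muN t : g_mu mu (- t) = g_mu mu t.
Proof. by rewrite /g_mu /reg1 normrN sqrrN. Qed.

Lemma subdifferential_g_muN x w :
  subdifferential (g_mu mu) x w -> subdifferential (g_mu mu) (- x) (- w).
Proof.
move=> xw t; rewrite g_muN -(g_muN t); apply: le_trans (xw (- t)).
by rewrite lerD2l mulNr -mulrN opprB (addrC (- x)).
Qed.

(** At positive points [g_mu mu] is differentiable with derivative [2 * Num.max s x]. Subgradients
    are written [2 * z] here and below because stationarity supplies them in this form. *)
Lemma subdifferential_g_mu_gt0 x z : 0 < x ->
  subdifferential (g_mu mu) x (2 * z) -> z = Num.max s x.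
Proof.
move=> x0 xz; have s0 : 0 < s by rewrite sqrtr_gt0.
have [sx|xs] := leP s x.
- (* g lies below the parabola mu + t^2 and touches it at x, so only the slope
     of the parabola is possible; testing at t = z shows it. *)
  have := le_trans (xz z) (g_mu_le z).
  rewrite g_mu_large ?gtr0_norm // => le_z.
  have : (z - x) ^+ 2 <= 0 by lra.
  by rewrite le_eqVlt ltNge sqr_ge0 orbF sqrf_eq0 subr_eq0 => /eqP.
(* On [[0, s]] the function is linear with slope [2 * s]; testing at the two ends gives [z >= s] and
   [z <= s]. *)
- have := xz 0; have := xz s.
  rewrite !g_mu_small ?normr0 ?gtr0_norm ?(ltW s0) ?(ltW xs) // => le_s le_0.
  have : x * (s - z) <= 0 by lra.
  have : (s - x) * (z - s) <= 0 by lra.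
  by rewrite pmulr_rle0 ?subr_gt0 // pmulr_rle0 //; lra.
Qed.

Lemma subdifferential_g_mu_lt0 x z : x < 0 ->
  subdifferential (g_mu mu) x (2 * z) -> z = - Num.max s (- x).
Proof.
move=> x0 /subdifferential_g_muN; rewrite -mulrN => xz.
by rewrite -(subdifferential_g_mu_gt0 _ xz) ?opprK // oppr_gt0.
Qed.

Lemma subdifferential_g_mu_0 z :
  subdifferential (g_mu mu) 0 (2 * z) -> `|z| <= s.
Proof.
move=> xz; have s0 : 0 < s by rewrite sqrtr_gt0.
have := xz s; have := xz (- s).
rewrite g_muN !g_mu_small ?normr0 ?(gtr0_norm s0) ?(ltW s0) // => le_N le_s.
have : s * (z - s) <= 0 by lra.
have : s * (- z - s) <= 0 by lra.
rewrite !pmulr_rle0 // ler_norml; lra.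
Qed.

(** The claim says that [z' - delta * x'] lies strictly on the same side of [z - delta * x] as [x']
    does of [x]. The two ends of the excluded interval are the thresholds at which this comparison
    could fail. *)
Lemma subdifferential_g_mu_strong (delta x x' z z' : R) :
  0 <= delta < 1 -> x' != x ->
  `|z| \notin `[(1 - delta) * s, s / (1 - delta)] ->
  subdifferential (g_mu mu) x (2 * z) ->
  subdifferential (g_mu mu) x' (2 * z') ->
  delta * (x' - x) ^+ 2 < (z' - z) * (x' - x).
Proof.
move=> /andP[d0 d1]; have s0 : 0 < s by rewrite sqrtr_gt0.
have e0 : 0 < 1 - delta by rewrite subr_gt0.
(* Since [g_mu mu] is even, negating both points and both slopes preserves everything. *)
wlog z0 : x x' z z' / 0 <= z => [hw|] neq_x gap xz xz'.
  have [|zN] := leP 0 z; first by move=> ?; apply: hw.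
  have := hw (- x) (- x') (- z) (- z').
  rewrite oppr_ge0 eqr_opp normrN !mulrN -!opprD mulrNN sqrrN.
  by apply=> //; rewrite ?ltW //; exact: subdifferential_g_muN.
rewrite -subr_gt0.
have -> : (z' - z) * (x' - x) - delta * (x' - x) ^+ 2 =
  (z' - z - delta * (x' - x)) * (x' - x) by ring.
have ds : 0 <= delta * s by apply: mulr_ge0; lra.
have z'E : [\/ 0 < x' /\ z' = Num.max s x', x' < 0 /\ z' = - Num.max s (- x')
             | x' = 0 /\ `|z'| <= s].
  have [x'0|x'0|x'0] := ltgtP x' 0.
  - by apply: Or32; split=> //; exact: subdifferential_g_mu_lt0.
  - by apply: Or31; split=> //; exact: subdifferential_g_mu_gt0.
  - by apply: Or33; split=> //; apply: subdifferential_g_mu_0; rewrite -x'0.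
move: gap; rewrite in_itv /= negb_and -!ltNge ger0_norm // => /orP[z_lt|z_gt].
(* Below the gap [z < s], while nonzero points have half-slopes of modulus at least [s]. *)
- have x0 : x = 0.
    apply/eqP; case: (ltgtP x 0) => // x0.
    + have := subdifferential_g_mu_lt0 x0 xz.
      have : s <= Num.max s (- x) by rewrite le_max lexx.
      lra.
    + have := subdifferential_g_mu_gt0 x0 xz.
      have : s <= Num.max s x by rewrite le_max lexx.
      lra.
  move: neq_x; rewrite x0 !subr0 => neq_x.
  case: z'E => [[x'0 ->]|[x'0 ->]|[x'0 _]]; last by rewrite x'0 eqxx in neq_x.
  (* For [x' > 0], [Num.max s x' - delta * x'] is smallest at the kink [x' = s], where it equals
     [(1 - delta) * s > z]. *)
  + rewrite pmulr_lgt0 //; have [sx'|x's] := leP s x'.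
      have : 0 <= (1 - delta) * (x' - s) by apply: mulr_ge0; lra.
      lra.
    have : 0 <= delta * (s - x') by apply: mulr_ge0; lra.
    lra.
  + rewrite nmulr_lgt0 //; have [sx'|x's] := leP s (- x').
      have : 0 <= (1 - delta) * (- x' - s) by apply: mulr_ge0; lra.
      lra.
    have : 0 <= delta * (s + x') by apply: mulr_ge0; lra.
    lra.
- rewrite ltr_pdivrMr // in z_gt.
  have zd : 0 <= z * delta by apply: mulr_ge0.
  (* Above the gap [z > s], which leaves only the quadratic branch of [g_mu mu]. *)
  have xE : x = z.
    case: (ltgtP x 0) => x0.
    + have := subdifferential_g_mu_lt0 x0 xz.
      have : s <= Num.max s (- x) by rewrite le_max lexx.
      lra.
    + have := subdifferential_g_mu_gt0 x0 xz.
      by have [|_] := leP s x; lra.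
    + move: xz; rewrite x0 => /subdifferential_g_mu_0; rewrite ger0_norm //; lra.
  rewrite {x xz}xE in neq_x *.
  have [x'z|zx'|/eqP] := ltgtP x' z; last by rewrite (negbTE neq_x).
  (* If [x'] is on the quadratic branch, [z' = x'] and [ez] suffices; otherwise
     [z' - delta * x' <= s < (1 - delta) * z]. *)
  + have ez : 0 < (1 - delta) * (z - x') by apply: mulr_gt0; lra.
    rewrite nmulr_lgt0 ?subr_lt0 //.
    case: z'E => [[x'0 ->]|[x'0 ->]|[x'0]].
    * have dx : 0 <= delta * x' by apply: mulr_ge0; lra.
      by have [sx'|x's] := leP s x'; lra.
    * have [sx'|x's] := leP s (- x'); first lra.
      have : 0 <= delta * (s + x') by apply: mulr_ge0; lra.
      lra.
    * rewrite x'0 ler_norml; lra.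
  (* Here [x' > z > s], so [z' = x']. *)
  + have ez : 0 < (1 - delta) * (x' - z) by apply: mulr_gt0; lra.
    rewrite pmulr_lgt0 ?subr_gt0 //.
    case: z'E => [[x'0 ->]|[x'0 _]|[x'0 _]]; [|lra|lra].
    by have [sx'|x's] := leP s x'; lra.
Qed.

End ScalarSubdifferential.

Theorem theorem3p5 (R : realType) (m n : nat) (A : 'M[R]_(m, n))
    (b : 'cV[R]_m) (mu : R) (c : nat) (delta : R) (xs xs' : 'cV[R]_n) :
  0 < mu ->
  (0 < c)%N ->
  0 <= delta < 1 ->
  restricted_isometry A c delta ->
  stationary mu A b xs ->
  (let z := (1%:M - A^T *m A) *m xs + A^T *m b in
   forall i, `|z i 0| \notin
     `[(1 - delta) * Num.sqrt mu, Num.sqrt mu / (1 - delta)]) ->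
  xs' != xs ->
  stationary mu A b xs' ->
  (c < card_nz (xs' - xs))%N.
Proof.
move=> mu0 _ dlt rip; rewrite /stationary -!scalerDr.
set z := (X in 2 *: X) => st gap neq_x.
set z' := (X in 2 *: X) => st'.
set d := xs' - xs; rewrite ltnNge; apply/negP => /rip /andP[rip_d _].
have zd : \sum_i (z' i 0 - z i 0) * d i 0 = enorm d ^+ 2 - enorm (A *m d) ^+ 2.
  (* The terms in [b] cancel. *)
  have zE : z' - z = d - A^T *m (A *m d).
    by rewrite /z' /z opprD addrACA subrr addr0 -mulmxBr mulmxBl mul1mx mulmxA.
  have -> : \sum_i (z' i 0 - z i 0) * d i 0 = (d^T *m (z' - z)) 0 0.
    by rewrite mxE; apply: eq_bigr => i _; rewrite !mxE mulrC.
  by rewrite zE mulmxBr !enorm_sqr trmx_mul !mulmxA !mxE.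
have strict i : d i 0 != 0 -> delta * d i 0 ^+ 2 < (z' i 0 - z i 0) * d i 0.
  move: (st i) (st' i); rewrite [(2 *: z) _ _]mxE [(2 *: z') _ _]mxE => sti sti'.
  rewrite [d i 0]mxE [(- xs) i 0]mxE subr_eq0 => neq_xi.
  exact: subdifferential_g_mu_strong (gap i) sti sti'.
have weak i : delta * d i 0 ^+ 2 <= (z' i 0 - z i 0) * d i 0.
  by have [->|/strict/ltW //] := eqVneq (d i 0) 0; rewrite expr0n !mulr0.
(* One strict coordinate makes the summed inequality strict, contradicting [zd] with [rip_d]. *)
have [i0 di0] : exists i, d i 0 != 0.
  apply/existsP; apply: contraNT neq_x => /existsPn d0.
  rewrite -subr_eq0; apply/eqP/colP => i; rewrite [RHS]mxE.
  by apply/eqP; rewrite -[_ == _]negbK d0.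
have : delta * enorm d ^+ 2 < \sum_i (z' i 0 - z i 0) * d i 0.
  rewrite /enorm sqr_sqrtr; last by apply: sumr_ge0 => i _; exact: sqr_ge0.
  rewrite mulr_sumr (bigD1 i0) //= [ltRHS](bigD1 i0) //=.
  by apply: ltr_leD; [exact: strict | apply: ler_sum].
by rewrite zd; lra.
Qed.
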